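(* Let $F,f,g$ satisfy the Standing Assumption, assume $\nabla F$ is Lipschitz continuous on bounded sets, and let $\{z^k\}=\{(W^k,H^k)\}$ be generated by the accPALM scheme from $z^0$ and be bounded. Let $\omega(z^0)$ be its set of limit points, suppose $J\equiv J^*$ on $\omega(z^0)$, and suppose $J$ has the KL property at the points of $\omega(z^0)$ with desingularizing function $\varphi(t)=\frac{c}{\theta}t^{\theta}$, where $\theta\in(0,1]$ and $c>0$. Let $r_k=J(z^k)-J^*$. Then there is $k_2$ such that for all $k\ge k_2$: (1) if $\theta=1$, then $r_k=0$ after finitely many steps; (2) if $\theta\in[\tfrac12,1)$, then there exists $P\in[0,1)$ with $r_k\le r_{k_2}P^{\,k-k_2}$; (3) if $\theta\in(0,\tfrac12)$, then there exists $Q>0$ with $r_k\le\Big(\frac{Q}{(k-k_2)(1-2\theta)}\Big)^{\frac{1}{1-2\theta}}$ for $k>k_2$.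
   Context: Setting. Let $p,r,n$ be positive integers. For matrices, $\|\cdot\|$ denotes the Frobenius norm, and for pairs $\|(A,B)\|=(\|A\|^2+\|B\|^2)^{1/2}$. Consider $J(W,H)=F(W,H)+f(W)+g(H)$ with $W\in\mathbb R^{p\times r}$, $H\in\mathbb R^{r\times n}$. $\partial$ denotes the limiting subdifferential. KL property at $\bar z$ with desingularizing function $\varphi$: there exist $\eta>0$ and a neighborhood $U$ of $\bar z$ such that $\varphi'(J(z)-J(\bar z))\operatorname{dist}(0,\partial J(z))\ge1$ for all $z\in U$ with $J(\bar z)<J(z)<J(\bar z)+\eta$. Standing Assumption: (a) $f:\mathbb R^{p\times r}\to(-\infty,+\infty]$ and $g:\mathbb R^{r\times n}\to(-\infty,+\infty]$ are proper and lower semicontinuous; (b) $\inf J>-\infty$, $\inf f>-\infty$, $\inf g>-\infty$; (c) $F$ is $C^1$; for every fixed $H$, $W\mapsto\nabla_W F(W,H)$ is Lipschitz with constant $L_W$ (independent of $H$), and for every fixed $W$, $H\mapsto \nabla_H F(W,H)$ is Lipschitz with constant $L_H$ (independent of $W$). Proximal map: for a proper lsc $\sigma$ and $t>0$, $\operatorname{prox}^\sigma_t(x)=\operatorname{argmin}_u\{\sigma(u)+\tfrac t2\|u-x\|^2\}$ (any element may be chosen). accPALM scheme. Fix $\rho_0>0$ and $\beta_{\max}\in[0,1)$. Start from $(W^0,H^0)$ with $f(W^0),g(H^0)<\infty$ and set $(W^{-1},H^{-1})=(W^0,H^0)$. At iteration $k\ge0$: pick $\beta_k\in[0,\beta_{\max}]$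 and step sizes $c_k,d_k$ with $L_W+2\rho_0\le c_k\le \bar c$, $L_H+2\rho_0\le d_k\le\bar d$ for fixed constants $\bar c,\bar d$. Form $\widehat W=W^k+\beta_k(W^k-W^{k-1})$, $\widehat H=H^k+\beta_k(H^k-H^{k-1})$, and compute $W'\in\operatorname{prox}^f_{c_k}(\widehat W-\tfrac1{c_k}\nabla_W F(\widehat W,\widehat H))$, $H'\in\operatorname{prox}^g_{d_k}(\widehat H-\tfrac1{d_k}\nabla_H F(W',\widehat H))$. If $J(W',H')\le J(W^k,H^k)-\rho_0\|(W'-\widehat W,H'-\widehat H)\|^2$, set $(W^{k+1},H^{k+1})=(W',H')$. Otherwise compute $W^{k+1}\in\operatorname{prox}^f_{c_k}(W^k-\tfrac1{c_k}\nabla_W F(W^k,H^k))$, $H^{k+1}\in\operatorname{prox}^g_{d_k}(H^k-\tfrac1{d_k}\nabla_H F(W^{k+1},H^k))$. Notation: $z^k=(W^k,H^k)$. *)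

(* Defs.v *)
From HB Require Import structures.
From mathcomp Require Import all_boot all_order all_algebra.
From mathcomp Require Import all_classical all_reals.
From mathcomp Require Import exp.
Set Implicit Arguments. Unset Strict Implicit. Unset Printing Implicit Defensive.
Import Order.TTheory GRing.Theory Num.Theory.
Local Open Scope ring_scope.

Section Defs.
Variable R : realType.

Definition mnorm2 {m k : nat} (A : 'M[R]_(m, k)) : R :=
  \sum_(i < m) \sum_(j < k) (A i j) ^+ 2.
Definition mdot {m k : nat} (A B : 'M[R]_(m, k)) : R :=
  \sum_(i < m) \sum_(j < k) A i j * B i j.
Definition mnorm {m k : nat} (A : 'M[R]_(m, k)) : R := Num.sqrt (mnorm2 A).

Variables p r n : nat.
Definition pt := ('M[R]_(p, r) * 'M[R]_(r, n))%type.

Definition padd (z1 z2 : pt) : pt := (z1.1 + z2.1, z1.2 + z2.2).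
Definition psub (z1 z2 : pt) : pt := (z1.1 - z2.1, z1.2 - z2.2).
Definition pnorm2 (z : pt) : R := mnorm2 z.1 + mnorm2 z.2.
Definition pnorm (z : pt) : R := Num.sqrt (pnorm2 z).
Definition pdot (z1 z2 : pt) : R := mdot z1.1 z2.1 + mdot z1.2 z2.2.

Definition lsc_mx {m k : nat} (s : 'M[R]_(m, k) -> \bar R) : Prop :=
  forall x (a : R), (a%:E < s x)%E ->
    exists2 d : R, 0 < d & forall y, mnorm (y - x) < d -> (a%:E < s y)%E.

Definition proper_mx {m k : nat} (s : 'M[R]_(m, k) -> \bar R) : Prop :=
  (forall x, (-oo < s x)%E) /\ exists x, (s x < +oo)%E.

Definition frechet_subdiff (J : pt -> \bar R) (z v : pt) : Prop :=
  (J z \is a fin_num) /\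
  forall eps : R, 0 < eps -> exists2 d : R, 0 < d &
    forall u, pnorm (psub u z) < d ->
      ((J z + (pdot v (psub u z) - eps * pnorm (psub u z))%:E) <= J u)%E.

Definition limiting_subdiff (J : pt -> \bar R) (z v : pt) : Prop :=
  exists (zs vs : nat -> pt),
    (forall k, frechet_subdiff J (zs k) (vs k)) /\
    (forall eps : R, 0 < eps -> exists N, forall k, (N <= k)%N ->
       pnorm (psub (zs k) z) < eps /\ pnorm (psub (vs k) v) < eps /\
       (`| J (zs k) - J z | < eps%:E)%E).

(* KL property at zbar with desingularizing function phi, given through its
   derivative dphi.  dist(0, dJ(z)) >= 1/phi'(.) is written out as
   "every v in dJ(z) has phi'(.) * ||v|| >= 1" (dist to the empty set = +oo). *)
Definition KL_at (J : pt -> \bar R) (zbar : pt) (dphi : R -> R) : Prop :=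
  exists2 eta : R, 0 < eta & exists2 d : R, 0 < d &
    forall z, pnorm (psub z zbar) < d ->
      (J zbar < J z)%E -> (J z < J zbar + eta%:E)%E ->
      forall v, limiting_subdiff J z v ->
        1 <= dphi (fine (J z - J zbar)) * pnorm v.

Definition is_prox {m k : nat} (s : 'M[R]_(m, k) -> \bar R) (t : R)
    (x u : 'M[R]_(m, k)) : Prop :=
  forall v, (s u + (t / 2 * mnorm2 (u - x))%:E <=
             s v + (t / 2 * mnorm2 (v - x))%:E)%E.

(* one iteration of accPALM: from z^{k-1} = zp, z^k = zk to z^{k+1} = zn,
   with extrapolation beta and step sizes c, d. *)
Definition accPALM_step (F : pt -> R) (f : 'M[R]_(p, r) -> \bar R)
    (g : 'M[R]_(r, n) -> \bar R)
    (gradW : pt -> 'M[R]_(p, r)) (gradH : pt -> 'M[R]_(r, n))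
    (rho0 beta c d : R) (zp zk zn : pt) : Prop :=
  let J := fun z : pt => ((F z)%:E + f z.1 + g z.2)%E in
  let What := zk.1 + beta *: (zk.1 - zp.1) in
  let Hhat := zk.2 + beta *: (zk.2 - zp.2) in
  exists (W' : 'M[R]_(p, r)) (H' : 'M[R]_(r, n)),
    is_prox f c (What - c^-1 *: gradW (What, Hhat)) W' /\
    is_prox g d (Hhat - d^-1 *: gradH (W', Hhat)) H' /\
    ( ((J (W', H') <= J zk - (rho0 * pnorm2 (W' - What, H' - Hhat))%:E)%E
        /\ zn = (W', H'))
    \/ (~ (J (W', H') <= J zk - (rho0 * pnorm2 (W' - What, H' - Hhat))%:E)%E
        /\ is_prox f c (zk.1 - c^-1 *: gradW zk) zn.1
        /\ is_prox g d (zk.2 - d^-1 *: gradH (zn.1, zk.2)) zn.2) ).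

Definition limit_point (zs : nat -> pt) (zbar : pt) : Prop :=
  exists phi : nat -> nat, (forall j, (phi j < phi j.+1)%N) /\
    forall eps : R, 0 < eps -> exists N, forall j, (N <= j)%N ->
      pnorm (psub (zs (phi j)) zbar) < eps.

End Defs.

(* Main.v *)
From HB Require Import structures.
From mathcomp Require Import all_boot all_order all_algebra.
From mathcomp Require Import all_classical all_reals.
From mathcomp Require Import topology normedtype sequences derive.
From mathcomp Require Import ring lra.
From mathcomp Require Import exp.
Require Import Defs.
Set Implicit Arguments. Unset Strict Implicit. Unset Printing Implicit Defensive.
Import Order.TTheory GRing.Theory Num.Theory.
Import numFieldNormedType.Exports.
Local Open Scope ring_scope.

(** Every iterate [z k.+1] is a proximal alternating linearized step from an
    anchor [y k], which is either the extrapolated point or [z k] itself, and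
    [J (z k.+1) <= J (z k) - rho0 * |z k.+1 - y k|^2] in both cases: by the
    acceptance test in the first, by the descent lemma in the second.  The
    optimality conditions of the two proximal maps give a subgradient of [J] at
    [z k.+1] of norm at most [C * |z k.+1 - y k|].  Since [z k.+1 - y k] tends to
    [0], lower semicontinuity and prox-optimality give [J (z k) --> Jstar].
    The KL inequality, valid along a tail by compactness, then yields
    [a * r_{k+1} ^ (2 (1 - theta)) <= r_k - r_{k+1}], a scalar recursion from
    which the three rates follow. *)

(** * Frobenius inner product and norm *)

Section MatrixInnerProduct.
Variables (R : realType) (m k : nat).
Implicit Types A B C : 'M[R]_(m, k).

Lemma mdotC A B : mdot A B = mdot B A.
Proof. by apply: eq_bigr => i _; apply: eq_bigr => j _; rewrite mulrC. Qed.

Lemma mdotDl A B C : mdot (A + B) C = mdot A C + mdot B C.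
Proof.
rewrite /mdot -big_split; apply: eq_bigr => i _.
by rewrite -big_split; apply: eq_bigr => j _; rewrite mxE mulrDl.
Qed.

Lemma mdotZl (a : R) A B : mdot (a *: A) B = a * mdot A B.
Proof.
rewrite /mdot mulr_sumr; apply: eq_bigr => i _.
by rewrite mulr_sumr; apply: eq_bigr => j _; rewrite mxE mulrA.
Qed.

Lemma mdotNl A B : mdot (- A) B = - mdot A B.
Proof. by rewrite -scaleN1r mdotZl mulN1r. Qed.

Lemma mdotDr A B C : mdot A (B + C) = mdot A B + mdot A C.
Proof. by rewrite mdotC mdotDl !(mdotC A). Qed.

Lemma mdotZr (a : R) A B : mdot A (a *: B) = a * mdot A B.
Proof. by rewrite mdotC mdotZl mdotC. Qed.

Lemma mdotNr A B : mdot A (- B) = - mdot A B.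
Proof. by rewrite mdotC mdotNl mdotC. Qed.

Definition mdotE := (mdotDl, mdotDr, mdotNl, mdotNr, mdotZl, mdotZr).

Lemma mnorm2E A : mnorm2 A = mdot A A.
Proof. by apply: eq_bigr => i _; apply: eq_bigr => j _; rewrite expr2. Qed.

Lemma mnorm2_ge0 A : 0 <= mnorm2 A.
Proof. by apply: sumr_ge0 => i _; apply: sumr_ge0 => j _; apply: sqr_ge0. Qed.

Lemma mnorm_ge0 A : 0 <= mnorm A. Proof. exact: sqrtr_ge0. Qed.

Lemma sqr_mnorm A : mnorm A ^+ 2 = mnorm2 A.
Proof. exact: sqr_sqrtr (mnorm2_ge0 A). Qed.

Lemma mnormN A : mnorm (- A) = mnorm A.
Proof. by rewrite /mnorm !mnorm2E !mdotE opprK. Qed.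

Lemma mnormZ (a : R) A : mnorm (a *: A) = `|a| * mnorm A.
Proof.
by rewrite /mnorm !mnorm2E !mdotE mulrA -expr2 sqrtrM ?sqr_ge0// sqrtr_sqr.
Qed.

Lemma mnorm0 : mnorm (0 : 'M[R]_(m, k)) = 0.
Proof. by rewrite -(scale0r (0 : 'M[R]_(m, k))) mnormZ normr0 mul0r. Qed.

Lemma mnorm20 : mnorm2 (0 : 'M[R]_(m, k)) = 0.
Proof. by rewrite -sqr_mnorm mnorm0 expr0n. Qed.

Lemma mdotr0 A : mdot A 0 = 0.
Proof. by rewrite -(scale0r (0 : 'M[R]_(m, k))) mdotZr mul0r. Qed.

Lemma mnorm_eq0 A : mnorm A = 0 -> A = 0.
Proof.
move=> A0; apply/matrixP => i j; rewrite mxE.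
have : mnorm2 A = 0 by rewrite -sqr_mnorm A0 expr0n.
move/eqP; rewrite psumr_eq0 => [/allP/(_ i)|i' _]; last first.
  by apply: sumr_ge0 => j' _; apply: sqr_ge0.
rewrite mem_index_enum => /(_ isT) /=.
rewrite psumr_eq0 => [/allP/(_ j)|j' _]; last exact: sqr_ge0.
by rewrite mem_index_enum => /(_ isT) /=; rewrite sqrf_eq0 => /eqP.
Qed.

Lemma mdot_le A B : mdot A B <= mnorm A * mnorm B.
Proof.
have [A0|A0] := eqVneq (mnorm A) 0.
  by rewrite A0 mul0r (mnorm_eq0 A0) mdotC mdotr0 lexx.
have [B0|B0] := eqVneq (mnorm B) 0.
  by rewrite B0 mulr0 (mnorm_eq0 B0) mdotr0 lexx.
have a0 : 0 < mnorm A by rewrite lt_neqAle eq_sym A0 mnorm_ge0.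
have b0 : 0 < mnorm B by rewrite lt_neqAle eq_sym B0 mnorm_ge0.
(* Cauchy-Schwarz: with [a], [b] the two norms and [d] the inner product, this square expands to
   [2 * a * b * (a * b - d)]. *)
have := mnorm2_ge0 (mnorm B *: A - mnorm A *: B).
rewrite mnorm2E !mdotE -!mnorm2E -!sqr_mnorm (mdotC B A).
move: (mnorm A) (mnorm B) (mdot A B) a0 b0 => a b d a0 b0 h.
have : 0 <= (2 * a * b) * (a * b - d) by move: h; lra.
by rewrite pmulr_rge0 ?subr_ge0// !mulr_gt0.
Qed.

Lemma mdot_ge A B : - (mnorm A * mnorm B) <= mdot A B.
Proof. by have := mdot_le (- A) B; rewrite mnormN mdotNl; lra. Qed.

Lemma ler_mnormD A B : mnorm (A + B) <= mnorm A + mnorm B.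
Proof.
rewrite -(@ler_pXn2r _ 2) ?nnegrE ?addr_ge0 ?mnorm_ge0//.
rewrite sqr_mnorm mnorm2E !mdotE -!mnorm2E -!sqr_mnorm (mdotC B A).
by have := mdot_le A B; nra.
Qed.

Lemma ler_mnormB A B : mnorm (A - B) <= mnorm A + mnorm B.
Proof. by rewrite -(mnormN B) ler_mnormD. Qed.

Lemma mnormBC A B : mnorm (A - B) = mnorm (B - A).
Proof. by rewrite -mnormN opprB. Qed.

Lemma ler_mnorm_trans A B C : mnorm (A - C) <= mnorm (A - B) + mnorm (B - C).
Proof. by rewrite -[A - C](subrKA B) ler_mnormD. Qed.

Lemma ler_norm_mnorm A i j : `|A i j| <= mnorm A.
Proof.
rewrite -(@ler_pXn2r _ 2) ?nnegrE ?normr_ge0 ?mnorm_ge0//.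
rewrite sqr_mnorm -normrX ger0_norm ?sqr_ge0// /mnorm2 (bigD1 i)//= (bigD1 j)//=.
rewrite -addrA lerDl addr_ge0//; first by apply: sumr_ge0 => *; apply: sqr_ge0.
by apply: sumr_ge0 => *; apply: sumr_ge0 => *; apply: sqr_ge0.
Qed.

End MatrixInnerProduct.

(** * Norm on pairs of matrices *)

Section PairNorm.
Variables (R : realType) (p r n : nat).
Local Notation pt := (pt R p r n).
Implicit Types z w u : pt.

(* A linear isometry, which reduces facts on [pnorm] to facts on [mnorm]. *)
Definition flat z : 'rV[R]_(p * r + r * n) := row_mx (mxvec z.1) (mxvec z.2).

Definition unflat (v : 'rV[R]_(p * r + r * n)) : pt :=
  (vec_mx (lsubmx v), vec_mx (rsubmx v)).

Lemma unflatK v : flat (unflat v) = v.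
Proof. by rewrite /flat /= !vec_mxK hsubmxK. Qed.

Lemma mdot_mxvec (a b : nat) (A B : 'M[R]_(a, b)) :
  mdot (mxvec A) (mxvec B) = mdot A B.
Proof.
rewrite /mdot big_ord1 (reindex _ (curry_mxvec_bij _ _)) /= pair_big /=.
by apply: eq_bigr => -[i j] _ /=; rewrite !mxvecE.
Qed.

Lemma flat_dot z w : mdot (flat z) (flat w) = pdot z w.
Proof.
rewrite /pdot -(mdot_mxvec z.1) -(mdot_mxvec z.2) /mdot !big_ord1 big_split_ord /=.
by congr (_ + _); apply: eq_bigr => i _; rewrite ?row_mxEl ?row_mxEr.
Qed.

Lemma flat_norm z : mnorm (flat z) = pnorm z.
Proof. by rewrite /mnorm mnorm2E flat_dot /pnorm /pnorm2 !mnorm2E. Qed.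

Lemma flat_sub z w : flat (psub z w) = flat z - flat w.
Proof. by rewrite /flat /= !linearB /= opp_row_mx add_row_mx. Qed.

Lemma pnorm_ge0 z : 0 <= pnorm z. Proof. exact: sqrtr_ge0. Qed.

Lemma pnorm2_ge0 z : 0 <= pnorm2 z.
Proof. by rewrite addr_ge0 ?mnorm2_ge0. Qed.

Lemma sqr_pnorm z : pnorm z ^+ 2 = pnorm2 z.
Proof. exact: sqr_sqrtr (pnorm2_ge0 z). Qed.

Lemma pdot_norm_le z w : `|pdot z w| <= pnorm z * pnorm w.
Proof. by rewrite -flat_dot -!flat_norm ler_norml mdot_ge mdot_le. Qed.

Lemma ler_pnormB z w : pnorm (psub z w) <= pnorm z + pnorm w.
Proof. by rewrite -!flat_norm flat_sub ler_mnormB. Qed.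

Lemma ler_pnormBr z w : pnorm z <= pnorm (psub z w) + pnorm w.
Proof.
by rewrite -!flat_norm flat_sub -{1}(subrK (flat w) (flat z)) ler_mnormD.
Qed.

Lemma mnorm_fst_le z : mnorm z.1 <= pnorm z.
Proof. by rewrite ler_sqrt ?pnorm2_ge0// lerDl mnorm2_ge0. Qed.

Lemma mnorm_snd_le z : mnorm z.2 <= pnorm z.
Proof. by rewrite ler_sqrt ?pnorm2_ge0// lerDr mnorm2_ge0. Qed.

Lemma pnorm_le_add z : pnorm z <= mnorm z.1 + mnorm z.2.
Proof.
rewrite -(@ler_pXn2r _ 2) ?nnegrE ?addr_ge0 ?mnorm_ge0 ?pnorm_ge0//.
rewrite sqr_pnorm /pnorm2 -!sqr_mnorm.
by have := mnorm_ge0 z.1; have := mnorm_ge0 z.2; nra.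
Qed.

Lemma pnorm_psub0 z : pnorm (psub z z) = 0.
Proof. by rewrite -flat_norm flat_sub subrr mnorm0. Qed.

End PairNorm.

(** * Sequential compactness in finite dimension *)

Section BolzanoWeierstrass.
Variable R : realType.

(** Induction on the list of coordinates: each new coordinate is handled by a further extraction,
    which keeps the limits already obtained. *)
Lemma bolzano_weierstrass_coord (I : eqType) (x : nat -> I -> R) (M : R)
    (s : seq I) : (forall k i, `|x k i| <= M) ->
  exists phi : nat -> nat, (forall j, (phi j < phi j.+1)%N) /\
  exists l : I -> R, forall i, i \in s -> forall eps, 0 < eps ->
    exists N, forall j, (N <= j)%N -> `|x (phi j) i - l i| < eps.
Proof.
move=> bx; elim: s => [|i0 s [phi [phiS [l lP]]]].
  by exists id; split=> //; exists (fun=> 0).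
have [|psi psiS /cvg_ex[l0 l0P]] := @bolzano_weierstrass R (fun j => x (phi j) i0).
  exists M; split; first exact: num_real.
  by move=> a Ma j _ /=; apply: le_trans (bx _ _) (ltW Ma).
have psiS' j : (psi j < psi j.+1)%N by move/increasing_seqP : psiS; exact.
have phi_lt := homo_ltn ltn_trans phiS.
have psi_ge j : (j <= psi j)%N.
  by elim: j => // j IH; apply: leq_ltn_trans IH (psiS' j).
exists (phi \o psi); split=> [j|]; first exact: phi_lt.
exists (fun i => if i == i0 then l0 else l i) => i; rewrite inE.
case: eqP => [-> _|_ /= si] eps e0.
  move/cvgrPdist_lt : l0P => /(_ _ e0)[N _ NP]; exists N => j Nj /=.
  by rewrite distrC; apply: NP.
have [N NP] := lP i si eps e0; exists N => j Nj /=.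
by apply: NP; apply: leq_trans Nj (psi_ge j).
Qed.

Lemma bolzano_weierstrass_row (N : nat) (x : nat -> 'rV[R]_N) (M : R) :
  (forall k, mnorm (x k) <= M) ->
  exists phi : nat -> nat, (forall j, (phi j < phi j.+1)%N) /\
  exists l, forall eps, 0 < eps ->
    exists K, forall j, (K <= j)%N -> mnorm (x (phi j) - l) < eps.
Proof.
move=> bx.
have [|phi [phiS [l lP]]] := @bolzano_weierstrass_coord _
    (fun k i => x k 0 i) M (enum 'I_N).
  by move=> k i; apply: le_trans (bx k); apply: ler_norm_mnorm.
exists phi; split=> //; exists (\row_i l i) => eps e0.
(* Each coordinate within [e] gives a squared norm of at most [N * e ^+ 2], below [eps ^+ 2];
   dividing by [N + 1] also covers [N = 0]. *)
have [e e1 eE] : exists2 e, 0 < e & eps = e * (N%:R + 1).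
  have N1 : 0 < N%:R + 1 :> R by rewrite natr1 ltr0Sn.
  by exists (eps / (N%:R + 1)); rewrite ?divr_gt0 ?divfK ?gt_eqF.
have /choice[K KP] : forall i, exists K, forall j, (K <= j)%N ->
    `|x (phi j) 0 i - l i| < e.
  by move=> i; apply: lP => //; rewrite mem_enum.
exists (\max_i K i)%N => j Kj.
rewrite -(@ltr_pXn2r _ 2) ?nnegrE ?mnorm_ge0 ?(ltW e0)// sqr_mnorm.
rewrite /mnorm2 big_ord1.
apply: (@le_lt_trans _ _ (\sum_(i < N) e ^+ 2)).
  apply: ler_sum => i _; rewrite !mxE -real_normK ?num_real//.
  rewrite ler_pXn2r ?nnegrE ?normr_ge0 ?(ltW e1)//.
  by apply/ltW/KP; apply: leq_trans Kj; apply: leq_bigmax.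
rewrite sumr_const card_ord -mulr_natl eE.
have : 0 <= N%:R :> R by [].
by rewrite exprMn [ltLHS]mulrC ltr_pM2l ?exprn_gt0//; nra.
Qed.

(** The predicate [P] lets the extraction run inside any infinite set of indices: these are
    enumerated increasingly by [s] first, and compactness is applied to [z \o s]. *)
Lemma bolzano_weierstrass_pair (p r n : nat) (z : nat -> pt R p r n) (M : R)
    (P : nat -> Prop) :
  (forall k, pnorm (z k) <= M) -> (forall K, exists2 k, (K <= k)%N & P k) ->
  exists phi : nat -> nat, (forall j, (phi j < phi j.+1)%N) /\
  (forall j, P (phi j)) /\
  exists l, forall eps, 0 < eps ->
    exists K, forall j, (K <= j)%N -> pnorm (psub (z (phi j)) l) < eps.
Proof.
move=> bz infP.
have /choice[nxt nxtP] : forall K, exists k, (K <= k)%N /\ P k.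
  by move=> K; have [k] := infP K; exists k.
pose s := fix s j := if j is j'.+1 then nxt (s j').+1 else nxt 0%N.
have sS j : (s j < s j.+1)%N by have [] := nxtP (s j).+1.
have sP j : P (s j).
  by case: j => [|j] /=; [have [] := nxtP 0%N | have [] := nxtP (s j).+1].
have s_lt := homo_ltn ltn_trans sS.
have [|phi [phiS [l lP]]] := @bolzano_weierstrass_row _ (fun j => flat (z (s j))) M.
  by move=> k; rewrite flat_norm.
exists (s \o phi); split=> [j|]; first exact: s_lt.
split=> [j|]; first exact: sP.
exists (unflat l) => eps /lP[K KP]; exists K => j /KP.
by rewrite -flat_norm flat_sub unflatK.
Qed.

End BolzanoWeierstrass.

(** * One-dimensional descent lemma *)

Section Descent.
Local Open Scope classical_set_scope.
Local Open Scope ring_scope.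
Variable R : realType.

Lemma is_derive_of_little_o (phi : R -> R) (t d : R) :
  (forall eps : R, 0 < eps -> exists2 del : R, 0 < del & forall h : R, `|h| < del ->
     `|phi (t + h) - phi t - d * h| <= eps * `|h|) -> is_derive t 1 phi d.
Proof.
move=> H.
have cv : h^-1 *: ((phi \o shift t) (h *: 1) - phi t) @[h --> 0^'] --> d.
  apply/cvgrPdist_le => eps e0; have [del del0 delP] := H eps e0.
  exists del => //= h /=; rewrite sub0r normrN => hd h0.
  have hn : 0 < `|h| by rewrite normr_gt0.
  rewrite -(ler_pM2r hn) -normrM mulrBl /GRing.scale /= mulr1 [h + t]addrC.
  rewrite mulrAC mulVf// mul1r distrC.
  exact: delP.
apply: DeriveDef; first by apply/cvg_ex; exists d.
exact: cvg_lim cv.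
Qed.

(** Mean value theorem for [psi], which is [phi] minus its quadratic upper model: the one-sided
    bound on [d] makes the derivative of [psi] nonpositive for [t >= 0], so [psi 1 <= psi 0]. *)
Lemma descent_line (phi d : R -> R) (L : R) :
  (forall t eps : R, 0 < eps -> exists2 del : R, 0 < del & forall h : R, `|h| < del ->
     `|phi (t + h) - phi t - d t * h| <= eps * `|h|) ->
  (forall t : R, 0 <= t -> d t - d 0 <= L * t) ->
  phi 1 <= phi 0 + d 0 + L / 2.
Proof.
move=> H dL.
pose psi (t : R) := phi t - (d 0 * t + L / 2 * t ^+ 2).
have dpsi (t : R) : is_derive t 1 psi (d t - (d 0 + L * t)).
  have Dphi := is_derive_of_little_o (H t).
  rewrite /psi; apply: is_derive_eq.
  by rewrite /GRing.scale /=; field.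
have cpsi : {within `[0, 1], continuous psi}.
  by apply: derivable_within_continuous => t _; have [] := dpsi t.
have [t /andP[t0 _] E] := @MVT_segment R psi _ 0 1 ler01 (fun t _ => dpsi t) cpsi.
have := dL t; rewrite bnd_simp in t0 => /(_ t0).
move: E; rewrite /psi; nra.
Qed.

End Descent.

(** * Optimality conditions for the proximal map *)

Section Prox.
Variables (R : realType) (m k : nat).
Variable s : 'M[R]_(m, k) -> \bar R.
Hypothesis s_proper : proper_mx s.

Lemma prox_fin t x u : is_prox s t x u -> s u \is a fin_num.
Proof.
move=> su; have [sN [v sv]] := s_proper; rewrite fin_numElt sN /=.
have := su v; have := sN v; case: (s v) sv => // b _ _.
by have := sN u; case: (s u).
Qed.

(** Completing the square: the prox at a gradient step from [y] minimizes [s] plus the linear model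
    of slope [G] plus [t / 2] times the squared distance to [y]. The constant [t^-1 / 2 * mdot G G]
    cancels. *)
Lemma prox_ineq t y G u v : 0 < t -> is_prox s t (y - t^-1 *: G) u ->
  ((s u + (mdot G (u - y) + t / 2 * mnorm2 (u - y))%:E) <=
   s v + (mdot G (v - y) + t / 2 * mnorm2 (v - y))%:E)%E.
Proof.
move=> t0 su; have t1 : t != 0 by rewrite gt_eqF.
have E w : t / 2 * mnorm2 (w - (y - t^-1 *: G)) =
    mdot G (w - y) + t / 2 * mnorm2 (w - y) + t^-1 / 2 * mdot G G.
  have -> : w - (y - t^-1 *: G) = (w - y) + t^-1 *: G by rewrite opprB addrCA addrC.
  rewrite !mnorm2E !mdotE [mdot w G]mdotC [mdot y G]mdotC.
  by field.
have := su v; rewrite !E [(_ + _ + t^-1 / 2 * _)%:E]EFinD [in leRHS]EFinD !addeA.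
by rewrite leeD2rE.
Qed.

(** Expanding the squared distance from [v] to [y] around [u] in [prox_ineq] shows that
    [- (t *: (u - y)) - G] is a proximal subgradient of [s] at [u]. The quadratic error replaces
    convexity. *)
Lemma prox_subgrad t y G u v : 0 < t -> is_prox s t (y - t^-1 *: G) u ->
  ((s u + (mdot (- (t *: (u - y)) - G) (v - u) - t / 2 * mnorm2 (v - u))%:E) <=
   s v)%E.
Proof.
move=> t0 su; have := prox_ineq v t0 su.
have := prox_fin su; case: (s u) => // b _.
have [sN _] := s_proper; have := sN v; case: (s v) => [c _|_ _|//]; last by rewrite leey.
rewrite -!EFinD !lee_fin !mnorm2E !mdotE.
rewrite [mdot y u]mdotC [mdot y v]mdotC [mdot v u]mdotC; lra.
Qed.

End Prox.

(** * Segments in the space of pairs *)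

Section PairLine.
Variables (R : realType) (p r n : nat).
Local Notation pt := (pt R p r n).
Implicit Types z w h : pt.

Definition pscale (t : R) h : pt := (t *: h.1, t *: h.2).

Lemma pnorm_pscale t h : pnorm (pscale t h) = `|t| * pnorm h.
Proof.
rewrite -!flat_norm -mnormZ; congr mnorm.
by rewrite /flat /pscale /= !linearZ scale_row_mx.
Qed.

Lemma pdot_pscaler t z h : pdot z (pscale t h) = t * pdot z h.
Proof. by rewrite /pdot /= !mdotZr mulrDr. Qed.

Lemma padd_psub z w : padd z (psub w z) = w.
Proof. by case: w => a b; rewrite /padd /psub /= !(addrC z.1, addrC z.2) !subrK. Qed.

Lemma padd_pscaleD z h s t :
  padd z (pscale (s + t) h) = padd (padd z (pscale s h)) (pscale t h).
Proof. by rewrite /padd /pscale /= !scalerDl !addrA. Qed.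

Lemma padd_pscale0 z h : padd z (pscale 0 h) = z.
Proof. by case: z => a b; rewrite /padd /pscale /= !scale0r !addr0. Qed.

Lemma padd_pscale1 z h : padd z (pscale 1 h) = padd z h.
Proof. by rewrite /padd /pscale /= !scale1r. Qed.

End PairLine.

(** * Descent and subgradients for one alternating proximal step *)

Section Objective.
Variables (R : realType) (p r n : nat).
Local Notation pt := (pt R p r n).
Variables (F : pt -> R) (f : 'M[R]_(p, r) -> \bar R) (g : 'M[R]_(r, n) -> \bar R).
Variables (gradW : pt -> 'M[R]_(p, r)) (gradH : pt -> 'M[R]_(r, n)).
Implicit Types y z w u h : pt.

Definition objective w : \bar R := ((F w)%:E + f w.1 + g w.2)%E.
Local Notation J := objective.
Local Notation grad w := ((gradW w, gradH w) : pt).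

Hypothesis f_proper : proper_mx f.
Hypothesis g_proper : proper_mx g.
Hypothesis F_diff : forall w (eps : R), 0 < eps -> exists2 del : R, 0 < del &
  forall h, pnorm h < del ->
    `| F (padd w h) - F w - pdot (grad w) h | <= eps * pnorm h.

Lemma objective_case w :
  J w = +oo%E \/ exists a b, [/\ f w.1 = a%:E, g w.2 = b%:E & J w = (F w + a + b)%:E].
Proof.
rewrite /objective; have [/(_ w.1) fN _] := f_proper; have [/(_ w.2) gN _] := g_proper.
case: (f w.1) fN => [a _| _|//]; case: (g w.2) gN => [b _|_|//]; try by left.
by right; exists a, b.
Qed.

Lemma objective_fin w : (J w < +oo)%E ->
  exists a b, [/\ f w.1 = a%:E, g w.2 = b%:E & J w = (F w + a + b)%:E].
Proof. by case: (objective_case w) => [->|//]; rewrite ltxx. Qed.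

(** Restriction of [F] to the line [w + t h]. Here [L] bounds the growth of the directional
    derivative, so it absorbs the squared length of [h]; this allows a Lipschitz bound in one block
    only. *)
Lemma descent_along w h L :
  (forall t, 0 <= t ->
     pdot (grad (padd w (pscale t h))) h - pdot (grad w) h <= L * t) ->
  F (padd w h) <= F w + pdot (grad w) h + L / 2.
Proof.
move=> HL; pose wt t := padd w (pscale t h).
have := @descent_line R (fun t => F (wt t)) (fun t => pdot (grad (wt t)) h) L.
rewrite /wt padd_pscale1 padd_pscale0; apply=> //= t eps e0.
(* The [+ 1] keeps the divisor positive when [h] vanishes. *)
have h1 : 0 < pnorm h + 1 by rewrite ltr_wpDl ?pnorm_ge0.
have [del d0 delP] := F_diff (wt t) (divr_gt0 e0 h1).
exists (del / (pnorm h + 1)); first exact: divr_gt0.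
move=> s; rewrite ltr_pdivlMr// => sd.
have sh : `|s| * pnorm h <= `|s| * (pnorm h + 1) by rewrite ler_wpM2l ?lerDl.
have := delP (pscale s h); rewrite pnorm_pscale => /(_ (le_lt_trans sh sd)).
rewrite padd_pscaleD pdot_pscaler [s * _]mulrC => /le_trans; apply.
rewrite -mulrA ler_pM2l// mulrCA ler_piMr// mulrC ler_pdivrMr// mul1r lerDl ler01 //.
Qed.

Lemma descent_fst LW (W W' : 'M[R]_(p, r)) (H : 'M[R]_(r, n)) :
  (forall W1 W2 H, mnorm (gradW (W1, H) - gradW (W2, H)) <= LW * mnorm (W1 - W2)) ->
  F (W', H) <= F (W, H) + mdot (gradW (W, H)) (W' - W) + LW / 2 * mnorm2 (W' - W).
Proof.
move=> lipW.
have hE : (W', H) = padd (W, H) (W' - W, 0) by rewrite /padd /= addr0 addrCA subrr addr0.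
have pE (w : pt) : pdot w (W' - W, 0) = mdot w.1 (W' - W).
  by rewrite /pdot /= mdotr0 addr0.
have := @descent_along (W, H) (W' - W, 0) (LW * mnorm2 (W' - W)).
rewrite -hE !pE /= mulrAC; apply => t t0; rewrite !pE /=.
rewrite -mdotNl -mdotDl; apply: le_trans (mdot_le _ _) _.
rewrite /padd /= scaler0 addr0.
have := lipW (W + t *: (W' - W)) W H.
rewrite addrAC subrr add0r mnormZ ger0_norm// -sqr_mnorm.
by have := mnorm_ge0 (W' - W); nra.
Qed.

Lemma descent_snd LH (W : 'M[R]_(p, r)) (H H' : 'M[R]_(r, n)) :
  (forall W H1 H2, mnorm (gradH (W, H1) - gradH (W, H2)) <= LH * mnorm (H1 - H2)) ->
  F (W, H') <= F (W, H) + mdot (gradH (W, H)) (H' - H) + LH / 2 * mnorm2 (H' - H).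
Proof.
move=> lipH.
have hE : (W, H') = padd (W, H) (0, H' - H) by rewrite /padd /= addr0 addrCA subrr addr0.
have pE (w : pt) : pdot w (0, H' - H) = mdot w.2 (H' - H).
  by rewrite /pdot /= mdotr0 add0r.
have := @descent_along (W, H) (0, H' - H) (LH * mnorm2 (H' - H)).
rewrite -hE !pE /= mulrAC; apply => t t0; rewrite !pE /=.
rewrite -mdotNl -mdotDl; apply: le_trans (mdot_le _ _) _.
rewrite /padd /= scaler0 addr0.
have := lipH W (H + t *: (H' - H)) H.
rewrite addrAC subrr add0r mnormZ ger0_norm// -sqr_mnorm.
by have := mnorm_ge0 (H' - H); nra.
Qed.

(** Common form of both branches of the scheme, with [y] the anchor. The second block already uses
    the updated [u.1]. *)
Definition palm_step (c d : R) y u : Prop :=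
  is_prox f c (y.1 - c^-1 *: gradW y) u.1 /\
  is_prox g d (y.2 - d^-1 *: gradH (u.1, y.2)) u.2.

(** Gradient of [F] at [u] plus the proximal subgradients of [f] and [g] supplied by
    [prox_subgrad]. *)
Definition palm_subgrad (c d : R) y u : pt :=
  (gradW u + (- (c *: (u.1 - y.1)) - gradW y),
   gradH u + (- (d *: (u.2 - y.2)) - gradH (u.1, y.2))).

(** The prox inequalities tested at [y.1] and [y.2] are added to the block descent lemmas along [y],
    [(u.1, y.2)], [u]. The linear terms cancel, leaving the margins [(c - LW) / 2] and
    [(d - LH) / 2], both at least [rho]. *)
Lemma palm_step_descent LW LH rho c d y u :
  (forall W1 W2 H, mnorm (gradW (W1, H) - gradW (W2, H)) <= LW * mnorm (W1 - W2)) ->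
  (forall W H1 H2, mnorm (gradH (W, H1) - gradH (W, H2)) <= LH * mnorm (H1 - H2)) ->
  0 < c -> 0 < d -> LW + 2 * rho <= c -> LH + 2 * rho <= d ->
  (J y < +oo)%E -> palm_step c d y u ->
  (J u <= J y - (rho * pnorm2 (psub u y))%:E)%E.
Proof.
move=> lipW lipH c0 d0 cL dL Jy [pW pH].
have [a [b [fa gb ->]]] := objective_fin Jy.
have := prox_ineq y.1 c0 pW; have := prox_ineq y.2 d0 pH.
have := prox_fin g_proper pH; have := prox_fin f_proper pW.
rewrite /objective fa gb; case: (f u.1) => // a' _; case: (g u.2) => // b' _.
rewrite -!EFinD !lee_fin !subrr !mdotr0 !mnorm20.
have := descent_fst y.1 u.1 y.2 lipW; have := descent_snd u.1 y.2 u.2 lipH.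
rewrite -!surjective_pairing /pnorm2 /=.
have : 0 <= (c - LW - 2 * rho) * mnorm2 (u.1 - y.1).
  by rewrite mulr_ge0 ?mnorm2_ge0//; lra.
have : 0 <= (d - LH - 2 * rho) * mnorm2 (u.2 - y.2).
  by rewrite mulr_ge0 ?mnorm2_ge0//; lra.
lra.
Qed.

(** The vector is already a Frechet subgradient at [u], so constant sequences witness the limiting
    one. *)
Lemma palm_step_subdiff c d y u : 0 < c -> 0 < d -> palm_step c d y u ->
  limiting_subdiff J u (palm_subgrad c d y u).
Proof.
move=> c0 d0 [pW pH].
have ff := prox_fin f_proper pW; have gf := prox_fin g_proper pH.
have Jf : J u \is a fin_num by rewrite /objective !fin_numD ff gf.
exists (fun=> u), (fun=> palm_subgrad c d y u); split; last first.
  move=> eps e0; exists 0%N => k _; rewrite !pnorm_psub0; split=> //; split=> //.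
  by rewrite subee// abse0 lte_fin.
move=> _; split=> // eps e0.
have [del del0 delP] := F_diff u (divr_gt0 e0 (ltr0Sn R 1)).
have cd : 0 < c + d by apply: addr_gt0.
(* Half of [eps] pays for the differentiability error of [F]; the radius [eps / (c + d)] makes the
   quadratic prox errors cost at most the other half. *)
exists (Num.min del (eps / (c + d))); first by rewrite lt_min del0 divr_gt0.
move=> v; rewrite lt_min ltr_pdivlMr// => /andP[vd ve].
have := delP _ vd; rewrite padd_psub ler_norml => /andP[+ _].
have [->|[a [b [fa gb ->]]]] := objective_case v; first by rewrite leey.
have := prox_subgrad f_proper v.1 c0 pW; have := prox_subgrad g_proper v.2 d0 pH.
rewrite /objective fa gb.
case: (f u.1) ff => // a' _; case: (g u.2) gf => // b' _.
rewrite -!EFinD !lee_fin {1 2}/pdot /= !mdotDl.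
have n1 := mnorm2_ge0 (v.1 - u.1); have n2 := mnorm2_ge0 (v.2 - u.2).
have : c / 2 * mnorm2 (v.1 - u.1) + d / 2 * mnorm2 (v.2 - u.2)
    <= eps / 2 * pnorm (psub v u).
  apply: (@le_trans _ _ ((c + d) / 2 * pnorm (psub v u) ^+ 2)).
    by rewrite sqr_pnorm /pnorm2 /=; nra.
  by have := pnorm_ge0 (psub v u); nra.
by rewrite /pdot /= !mdotNl; lra.
Qed.

(** Each block is a gradient difference plus a multiple of a displacement. The second difference
    starts at the mixed point [(u.1, y.2)], which must therefore lie in the ball too; [L] may be
    negative, hence its absolute value. *)
Lemma palm_subgrad_le L B c d cbar dbar y u :
  (forall z1 z2, pnorm z1 <= B -> pnorm z2 <= B ->
     pnorm (psub (grad z1) (grad z2)) <= L * pnorm (psub z1 z2)) ->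
  pnorm y <= B -> pnorm u <= B -> pnorm ((u.1, y.2) : pt) <= B ->
  0 < c <= cbar -> 0 < d <= dbar ->
  pnorm (palm_subgrad c d y u) <= (2 * `|L| + cbar + dbar) * pnorm (psub u y).
Proof.
move=> lip yB uB xB /andP[c0 cb] /andP[d0 db].
apply: le_trans (pnorm_le_add _) _ => /=.
have nW : mnorm (gradW u + (- (c *: (u.1 - y.1)) - gradW y)) <=
    mnorm (gradW u - gradW y) + c * mnorm (u.1 - y.1).
  rewrite -{2}(gtr0_norm c0) -mnormZ addrCA addrC; exact: ler_mnormB.
have nH : mnorm (gradH u + (- (d *: (u.2 - y.2)) - gradH (u.1, y.2))) <=
    mnorm (gradH u - gradH (u.1, y.2)) + d * mnorm (u.2 - y.2).
  rewrite -{2}(gtr0_norm d0) -mnormZ addrCA addrC; exact: ler_mnormB.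
have lW : mnorm (gradW u - gradW y) <= `|L| * pnorm (psub u y).
  apply: le_trans (mnorm_fst_le (psub (grad u) (grad y))) _.
  by apply: le_trans (lip _ _ uB yB) _; rewrite ler_wpM2r ?pnorm_ge0 ?ler_norm.
have lH : mnorm (gradH u - gradH (u.1, y.2)) <= `|L| * pnorm (psub u y).
  apply: le_trans (mnorm_snd_le (psub (grad u) (grad (u.1, y.2)))) _.
  apply: le_trans (lip _ _ uB xB) _.
  apply: (@le_trans _ _ (`|L| * pnorm (psub u (u.1, y.2)))).
    by rewrite ler_wpM2r ?pnorm_ge0 ?ler_norm.
  rewrite ler_wpM2l// (le_trans (pnorm_le_add _))//= subrr mnorm0 add0r.
  exact: mnorm_snd_le (psub u y).
have : c * mnorm (u.1 - y.1) <= cbar * pnorm (psub u y).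
  by rewrite ler_pM ?mnorm_ge0 ?(ltW c0) ?(mnorm_fst_le (psub u y)).
have : d * mnorm (u.2 - y.2) <= dbar * pnorm (psub u y).
  by rewrite ler_pM ?mnorm_ge0 ?(ltW d0) ?(mnorm_snd_le (psub u y)).
lra.
Qed.
End Objective.

(** * Convergence of the values and the recursion from the KL inequality *)

Section Convergence.
Variables (R : realType) (p r n : nat).
Local Notation pt := (pt R p r n).
Variables (F : pt -> R) (f : 'M[R]_(p, r) -> \bar R) (g : 'M[R]_(r, n) -> \bar R).
Variables (gradW : pt -> 'M[R]_(p, r)) (gradH : pt -> 'M[R]_(r, n)).
Local Notation J := (objective F f g).
Local Notation grad w := ((gradW w, gradH w) : pt).

Hypothesis f_proper : proper_mx f.
Hypothesis g_proper : proper_mx g.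
Hypothesis f_lsc : lsc_mx f.
Hypothesis g_lsc : lsc_mx g.
Hypothesis F_diff : forall (w : pt) (eps : R), 0 < eps ->
  exists2 del : R, 0 < del & forall h : pt, pnorm h < del ->
    `| F (padd w h) - F w - pdot (grad w) h | <= eps * pnorm h.

Lemma F_continuous (w : pt) (eps : R) : 0 < eps ->
  exists2 del : R, 0 < del & forall u : pt, pnorm (psub u w) < del ->
    `|F u - F w| < eps.
Proof.
move=> e0; have [del d0 delP] := F_diff w ltr01.
have G1 : 0 < pnorm (grad w) + 1 by rewrite ltr_wpDl ?pnorm_ge0.
exists (Num.min del (eps / (pnorm (grad w) + 1))); first by rewrite lt_min d0 divr_gt0.
move=> u; rewrite lt_min ltr_pdivlMr// => /andP[ud ue].
have := delP _ ud; rewrite padd_psub => Fu.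
have := lerD Fu (pdot_norm_le (grad w) (psub u w)).
by move/(le_trans (ler_normD _ _)); rewrite subrK; lra.
Qed.

Lemma objective_lsc (w : pt) (v eps : R) : J w = v%:E -> 0 < eps ->
  exists2 del : R, 0 < del & forall u : pt, pnorm (psub u w) < del ->
    ((v - eps)%:E < J u)%E.
Proof.
move=> Jw e0; have Jfin : (J w < +oo)%E by rewrite Jw ltry.
have [a [b [fa gb]]] := objective_fin f_proper g_proper Jfin.
rewrite Jw => -[vE].
have e3 : 0 < eps / 3 by lra.
have [|d1 d10 d1P] := @f_lsc w.1 (a - eps / 3); first by rewrite fa lte_fin; lra.
have [|d2 d20 d2P] := @g_lsc w.2 (b - eps / 3); first by rewrite gb lte_fin; lra.
have [d3 d30 d3P] := F_continuous w e3.
exists (Num.min d1 (Num.min d2 d3)); first by rewrite !lt_min d10 d20.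
move=> u; rewrite !lt_min => /and3P[u1 u2 u3].
have := d1P u.1 (le_lt_trans (mnorm_fst_le (psub u w)) u1).
have := d2P u.2 (le_lt_trans (mnorm_snd_le (psub u w)) u2).
have := d3P u u3; rewrite ltr_norml => /andP[F3 _].
have [->|[a' [b' [-> -> ->]]]] := objective_case F f_proper g_proper u.
  by rewrite ltry.
by rewrite !lte_fin vE; lra.
Qed.

(** Prox-optimality tested at [v] gives the upper bound on values that lower semicontinuity cannot
    give. Since [v] is within [2 * del] of [y], the quadratic term is at most [2 * t * del ^+ 2],
    and [del <= 1] makes it linear in [del]. *)
Lemma prox_value_le (m k : nat) (s : 'M[R]_(m, k) -> \bar R) t tbar y G u v Gm
    del (a b : R) :
  0 < t <= tbar -> is_prox s t (y - t^-1 *: G) u -> mnorm G <= Gm ->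
  mnorm (u - v) <= del -> mnorm (u - y) <= del -> del <= 1 ->
  s v = a%:E -> s u = b%:E -> b <= a + (Gm + 2 * tbar) * del.
Proof.
move=> /andP[t0 tb] su GGm uv uy d1 sv sb.
have := prox_ineq v t0 su; rewrite sv sb -!EFinD lee_fin -!sqr_mnorm.
have vy : mnorm (v - y) <= 2 * del.
  by have := ler_mnorm_trans v u y; rewrite (mnormBC v u); lra.
have del0 : 0 <= del := le_trans (mnorm_ge0 _) uv.
have : mdot G (v - y) - mdot G (u - y) <= Gm * del.
  have -> : mdot G (v - y) - mdot G (u - y) = mdot G (v - u) by rewrite !mdotE; ring.
  apply: le_trans (mdot_le _ _) _.
  by rewrite ler_pM ?mnorm_ge0// mnormBC.
have : t / 2 * mnorm (v - y) ^+ 2 <= 2 * tbar * del.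
  apply: (@le_trans _ _ (t / 2 * (2 * del) ^+ 2)).
    by rewrite ler_pM2l ?divr_gt0// ler_sqr ?nnegrE ?mnorm_ge0// mulr_ge0.
  have -> : t / 2 * (2 * del) ^+ 2 = 2 * (t * (del * del)) by field.
  by rewrite -mulrA ler_pM2l// ler_pM ?(ltW t0) ?mulr_ge0// ler_piMr.
have : 0 <= t / 2 * mnorm (u - y) ^+ 2 by rewrite mulr_ge0 ?divr_ge0 ?sqr_ge0// ltW.
lra.
Qed.

Variables (z y : nat -> pt) (ck dk : nat -> R) (cbar dbar rho M L Jstar : R).
Hypothesis rho_gt0 : 0 < rho.
Hypothesis z_step : forall k, palm_step f g gradW gradH (ck k) (dk k) (y k) (z k.+1).
Hypothesis z_descent : forall k,
  (J (z k.+1) <= J (z k) - (rho * pnorm2 (psub (z k.+1) (y k)))%:E)%E.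
Hypothesis z0_fin : (J (z 0%N) < +oo)%E.
Hypothesis z_bnd : forall k, pnorm (z k) <= M.
Hypothesis y_bnd : forall k, pnorm (y k) <= 3 * M.
Hypothesis ck_bnd : forall k, 0 < ck k <= cbar.
Hypothesis dk_bnd : forall k, 0 < dk k <= dbar.
Hypothesis grad_lip : forall z1 z2 : pt, pnorm z1 <= 4 * M -> pnorm z2 <= 4 * M ->
  pnorm (psub (grad z1) (grad z2)) <= L * pnorm (psub z1 z2).
Hypothesis J_omega : forall zbar, limit_point z zbar -> J zbar = Jstar%:E.

Let Jr k : R := fine (J (z k)).

Lemma z_fin k : (J (z k) < +oo)%E.
Proof.
elim: k => [//|k IH]; apply: le_lt_trans (z_descent k) _.
by have [a [b [_ _ ->]]] := objective_fin f_proper g_proper IH; rewrite -EFinB ltry.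
Qed.

Lemma z_fine k : J (z k) = (Jr k)%:E.
Proof.
by have [a [b [_ _ E]]] := objective_fin f_proper g_proper (z_fin k); rewrite /Jr E.
Qed.

Lemma Jr_descent k : rho * pnorm (psub (z k.+1) (y k)) ^+ 2 <= Jr k - Jr k.+1.
Proof. by have := z_descent k; rewrite !z_fine -EFinB lee_fin sqr_pnorm; lra. Qed.

Lemma Jr_nonincr i j : (i <= j)%N -> Jr j <= Jr i.
Proof.
apply: (nonincreasing_seqP _).1 i j => k.
have := Jr_descent k.
by have := mulr_ge0 (ltW rho_gt0) (sqr_ge0 (pnorm (psub (z k.+1) (y k)))); lra.
Qed.

(** Form in which compactness is used below: a property that recurs forever recurs arbitrarily late
    and arbitrarily close to one limit point. *)
Lemma limit_point_along (P : nat -> Prop) : (forall K, exists2 k, (K <= k)%N & P k) ->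
  exists2 zbar, limit_point z zbar & forall (K : nat) (eps : R), 0 < eps ->
    exists k, [/\ (K <= k)%N, P k & pnorm (psub (z k) zbar) < eps].
Proof.
move=> infP; have [phi [phiS [phiP [l lP]]]] := bolzano_weierstrass_pair z_bnd infP.
have phi_ge j : (j <= phi j)%N by elim: j => // j IH; apply: leq_ltn_trans IH (phiS j).
exists l; first by exists phi.
move=> K eps /lP[K' K'P]; exists (phi (maxn K K')); split=> //.
- exact: leq_trans (leq_maxl _ _) (phi_ge _).
- exact: K'P (leq_maxr _ _).
Qed.

(** A value below [Jstar] would, by monotonicity, bound all later values, against lower
    semicontinuity at a limit point. *)
Lemma Jstar_le k : Jstar <= Jr k.
Proof.
rewrite leNgt; apply/negP => Jk.
have [|l ll lP] := @limit_point_along (fun=> True); first by move=> K; exists K.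
have e0 : 0 < Jstar - Jr k by rewrite subr_gt0.
have [del d0 delP] := objective_lsc (J_omega ll) e0.
have [j [kj _ /delP]] := lP k del d0.
by rewrite z_fine lte_fin; have := Jr_nonincr kj; lra.
Qed.

(** Once [Jr] is within [rho * eps ^+ 2] of its infimum, no later decrease can reach that amount,
    and the decrease dominates [rho] times the squared distance. *)
Lemma anchor_dist_vanishes eps : 0 < eps -> exists N, forall k, (N <= k)%N ->
  pnorm (psub (z k.+1) (y k)) < eps.
Proof.
move=> e0; have e1 : 0 < rho * eps ^+ 2 by rewrite mulr_gt0 ?exprn_gt0.
have hi : has_inf (range Jr).
  by split; [exists (Jr 0%N), 0%N | exists Jstar => _ [k _ <-]; exact: Jstar_le].
have [_ [N _ <-] JN] := inf_adherent e1 hi.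
exists N => k Nk.
rewrite -(@ltr_pXn2r _ 2) ?nnegrE ?pnorm_ge0 ?(ltW e0)// -(ltr_pM2l rho_gt0).
apply: le_lt_trans (Jr_descent k) _.
have : inf (range Jr) <= Jr k.+1 by apply: ge_inf; [case: hi | exists k.+1].
by have := Jr_nonincr Nk; lra.
Qed.

Lemma M_ge0 : 0 <= M. Proof. exact: le_trans (pnorm_ge0 _) (z_bnd 0%N). Qed.

(** [M] from the iterate plus [3 * M] from the anchor; this sets the radius on which the gradient
    has to be Lipschitz. *)
Lemma mixed_bnd k : pnorm (((z k.+1).1, (y k).2) : pt) <= 4 * M.
Proof.
apply: le_trans (pnorm_le_add _) _ => /=.
have := mnorm_fst_le (z k.+1); have := mnorm_snd_le (y k).
by have := z_bnd k.+1; have := y_bnd k; lra.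
Qed.

Lemma grad_bounded : exists2 Gm, 0 <= Gm & forall w : pt, pnorm w <= 4 * M ->
  pnorm (grad w) <= Gm.
Proof.
have M4 : pnorm (z 0%N) <= 4 * M by have := z_bnd 0%N; have := M_ge0; lra.
exists (`|L| * (8 * M) + pnorm (grad (z 0%N))).
  by rewrite addr_ge0 ?pnorm_ge0// mulr_ge0// mulr_ge0 ?M_ge0.
move=> w wM; apply: le_trans (ler_pnormBr _ (grad (z 0%N))) _.
rewrite lerD2r; apply: le_trans (grad_lip wM M4) _.
apply: (@le_trans _ _ (`|L| * pnorm (psub w (z 0%N)))).
  by rewrite ler_wpM2r ?pnorm_ge0 ?ler_norm.
by rewrite ler_wpM2l//; have := ler_pnormB w (z 0%N); lra.
Qed.

(* Prox-optimality of the iterates tested against a limit point bounds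
   [f] and [g] from above along the subsequence; [f] and [g] need not be continuous. *)
Lemma Jr_cvg eps : 0 < eps -> exists N, Jr N < Jstar + eps.
Proof.
move=> e0; have e2 : 0 < eps / 2 by lra.
(* Positive indices only, so that the chosen iterate is the output of a proximal step. *)
have [|l ll lP] := @limit_point_along (fun k => (0 < k)%N).
  by move=> K; exists K.+1.
have Jl := J_omega ll; have Jlfin : (J l < +oo)%E by rewrite Jl ltry.
have [a [b [fa gb]]] := objective_fin f_proper g_proper Jlfin.
rewrite Jl => -[JE].
have [d1 d10 d1P] := F_continuous l e2.
have [Gm Gm0 GmP] := grad_bounded.
have cb : 0 < cbar by case/andP: (ck_bnd 0%N) => h1 h2; apply: lt_le_trans h1 h2.
have db : 0 < dbar by case/andP: (dk_bnd 0%N) => h1 h2; apply: lt_le_trans h1 h2.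
pose C := 2 * Gm + 2 * cbar + 2 * dbar.
have C0 : 0 < C by rewrite /C; lra.
(* [d1] controls [F] up to [eps / 2], [1] is required by [prox_value_le], and the errors of [f] and
   [g] add up to [C * del <= eps / 2]. *)
pose del := Num.min d1 (Num.min 1 (eps / 2 / C)).
have del0 : 0 < del by rewrite !lt_min d10 ltr01 divr_gt0.
have deld1 : del <= d1 by rewrite ge_min lexx.
have del1 : del <= 1 by rewrite /del !ge_min lexx orbT.
have delC : del <= eps / 2 / C by rewrite /del !ge_min lexx !orbT.
have [N NP] := anchor_dist_vanishes del0.
have [k1 [Nk _ kl]] := lP N.+1 del del0; case: k1 Nk kl => // k Nk kl.
have ky := NP k Nk.
have [a' [b' [fa' gb' JE']]] := objective_fin f_proper g_proper (z_fin k.+1).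
have [pW pH] := z_step k.
have yM : pnorm (y k) <= 4 * M by have := y_bnd k; have := M_ge0; lra.
have GW := le_trans (mnorm_fst_le _) (GmP _ yM).
have GH := le_trans (mnorm_snd_le _) (GmP _ (mixed_bnd k)).
have := prox_value_le (ck_bnd k) pW GW
  (ltW (le_lt_trans (mnorm_fst_le (psub _ l)) kl))
  (ltW (le_lt_trans (mnorm_fst_le (psub _ (y k))) ky)) del1 fa fa'.
have := prox_value_le (dk_bnd k) pH GH
  (ltW (le_lt_trans (mnorm_snd_le (psub _ l)) kl))
  (ltW (le_lt_trans (mnorm_snd_le (psub _ (y k))) ky)) del1 gb gb'.
have := d1P _ (lt_le_trans kl deld1); rewrite ltr_norml => /andP[_ Fk].
exists k.+1; rewrite /Jr JE' /= JE.
by move: delC; rewrite ler_pdivlMr// /C; lra.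
Qed.

Variables (c theta : R).
Hypothesis c_gt0 : 0 < c.
Hypothesis J_KL : forall zbar, limit_point z zbar ->
  KL_at J zbar (fun t => c * powR t (theta - 1)).

Let wk k := palm_subgrad gradW gradH (ck k) (dk k) (y k) (z k.+1).

(* KL holds only near each limit point; compactness makes it hold along the tail. *)
Lemma KL_eventually : exists K, forall k, (K <= k)%N -> 0 < Jr k.+1 - Jstar ->
  1 <= c * powR (Jr k.+1 - Jstar) (theta - 1) * pnorm (wk k).
Proof.
pose bad k := 0 < Jr k.+1 - Jstar /\
  ~ 1 <= c * powR (Jr k.+1 - Jstar) (theta - 1) * pnorm (wk k).
apply: contrapT => noK.
(* Infinitely many failures would accumulate at some [l]; late enough, the values are also below
   [Jstar + eta], so KL at [l] applies to a failing iterate. The shift is there because [bad k']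
   concerns [z k'.+1]. *)
have [|l ll lP] := @limit_point_along (fun k => exists2 k', k = k'.+1 & bad k').
  move=> K; apply: contrapT => noBad; apply: noK; exists K => k Kk rk.
  apply: contrapT => nk; apply: noBad; exists k.+1; first exact: leqW.
  by exists k.
have [eta eta0 [d d0 KL]] := J_KL ll.
have [N JN] := Jr_cvg eta0.
have [k [Nk [k' kE [rk nk]] kl]] := lP N d d0; rewrite {k}kE in Nk kl.
apply: nk; have := KL _ kl; rewrite (J_omega ll) z_fine -EFinD !lte_fin -EFinB /=.
apply.
- by rewrite -subr_gt0.
- exact: le_lt_trans (Jr_nonincr Nk) JN.
- have [c0 _] := andP (ck_bnd k'); have [d0' _] := andP (dk_bnd k').
  exact (palm_step_subdiff f_proper g_proper F_diff c0 d0' (z_step k')).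
Qed.

(** With [q] the distance to the anchor and [t] the new gap, KL and the subgradient bound give
    [1 <= c * t ^ (theta - 1) * C * q]. Squaring this and inserting [rho * q ^+ 2 <= Jr k - Jr k.+1]
    yields the claim with [a = rho / (c * C) ^+ 2]. *)
Lemma Jr_recursion : exists2 a, 0 < a & exists K, forall k, (K <= k)%N ->
  0 < Jr k.+1 - Jstar ->
  a * powR (Jr k.+1 - Jstar) (2 * (1 - theta)) <= (Jr k - Jstar) - (Jr k.+1 - Jstar).
Proof.
have [K KP] := KL_eventually.
have cb : 0 < cbar by case/andP: (ck_bnd 0%N) => h1 h2; apply: lt_le_trans h1 h2.
have db : 0 < dbar by case/andP: (dk_bnd 0%N) => h1 h2; apply: lt_le_trans h1 h2.
pose C := 2 * `|L| + cbar + dbar.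
have C0 : 0 < C by rewrite /C; have := normr_ge0 L; lra.
have cC0 : 0 < (c * C) ^+ 2 by rewrite exprn_gt0 ?mulr_gt0.
exists (rho / (c * C) ^+ 2); first by rewrite divr_gt0.
exists K => k Kk rk; have := KP k Kk rk.
set t := Jr k.+1 - Jstar in rk *.
have -> : Jr k - Jstar - t = Jr k - Jr k.+1 by rewrite /t; ring.
have yM : pnorm (y k) <= 4 * M by have := y_bnd k; have := M_ge0; lra.
have zM : pnorm (z k.+1) <= 4 * M by have := z_bnd k.+1; have := M_ge0; lra.
have := palm_subgrad_le grad_lip yM zM (mixed_bnd k) (ck_bnd k) (dk_bnd k).
rewrite -/(wk k) -/C; have := Jr_descent k.
have X0 : 0 < powR t (theta - 1) by apply: powR_gt0.
have YX : powR t (2 * (1 - theta)) * powR t (theta - 1) ^+ 2 = 1.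
  rewrite expr2 -!powRD ?(gt_eqF rk) ?implybT//.
  by rewrite (_ : _ + _ = 0) ?powRr0//; ring.
have Y0 := powR_ge0 t (2 * (1 - theta)).
move: (powR t (theta - 1)) (powR t (2 * (1 - theta))) X0 YX Y0 => X Y X0 YX Y0.
move: (pnorm (wk k)) (pnorm (psub _ _)) (Jr k - _) => w q D qD wq w1.
rewrite mulrAC ler_pdivrMr//.
have cX : 0 < c * X by rewrite mulr_gt0.
have h : 1 <= c * X * (C * q) by apply: le_trans w1 _; rewrite ler_pM2l.
have h2 : 1 <= (c * X * (C * q)) ^+ 2 by rewrite exprn_ege1.
have h3 : rho * Y <= rho * Y * (c * X * (C * q)) ^+ 2.
  by rewrite ler_peMr// mulr_ge0// ltW.
apply: le_trans h3 _.
have -> : rho * Y * (c * X * (C * q)) ^+ 2 = (Y * X ^+ 2) * (rho * q ^+ 2 * (c * C) ^+ 2).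
  by ring.
by rewrite YX mul1r ler_pM2r.
Qed.

End Convergence.

(** * From an accPALM iteration to an anchored proximal step *)

Lemma accPALM_anchor (R : realType) (p r n : nat) (F : pt R p r n -> R)
    (f : 'M[R]_(p, r) -> \bar R) (g : 'M[R]_(r, n) -> \bar R)
    (gradW : pt R p r n -> 'M[R]_(p, r)) (gradH : pt R p r n -> 'M[R]_(r, n))
    (rho beta c d M LW LH : R) (zp zk zn : pt R p r n) :
  proper_mx f -> proper_mx g ->
  (forall w : pt R p r n, forall eps : R, 0 < eps -> exists2 del : R, 0 < del &
     forall h : pt R p r n, pnorm h < del ->
       `| F (padd w h) - F w - pdot (gradW w, gradH w) h | <= eps * pnorm h) ->
  (forall W1 W2 H, mnorm (gradW (W1, H) - gradW (W2, H)) <= LW * mnorm (W1 - W2)) ->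
  (forall W H1 H2, mnorm (gradH (W, H1) - gradH (W, H2)) <= LH * mnorm (H1 - H2)) ->
  0 < c -> 0 < d -> LW + 2 * rho <= c -> LH + 2 * rho <= d -> 0 <= beta <= 1 ->
  pnorm zp <= M -> pnorm zk <= M -> (objective F f g zk < +oo)%E ->
  accPALM_step F f g gradW gradH rho beta c d zp zk zn ->
  exists y, [/\ pnorm y <= 3 * M, palm_step f g gradW gradH c d y zn &
    (objective F f g zn <= objective F f g zk - (rho * pnorm2 (psub zn y))%:E)%E].
Proof.
move=> fp gp Fd lW lH c0 d0 cL dL /andP[b0 b1] zpM zkM Jk.
move=> [W' [H' [pW [pH [[acc ->]|[_ [pW' pH']]]]]]].
  exists (zk.1 + beta *: (zk.1 - zp.1), zk.2 + beta *: (zk.2 - zp.2)); split=> //.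
  (* The triangle inequality then bounds the extrapolated point by [M + beta * (2 * M) <= 3 * M]. *)
  have -> : (zk.1 + beta *: (zk.1 - zp.1), zk.2 + beta *: (zk.2 - zp.2)) =
      psub zk (pscale (- beta) (psub zk zp)).
    by rewrite /psub /pscale /= !scaleNr !opprK.
  apply: le_trans (ler_pnormB _ _) _; rewrite pnorm_pscale normrN (ger0_norm b0).
  have := ler_pnormB zk zp; have := pnorm_ge0 (psub zk zp).
  by move: (pnorm (psub _ _)) => q; nra.
exists zk; split=> //; first by have := pnorm_ge0 zk; lra.
exact (palm_step_descent fp gp Fd lW lH c0 d0 cL dL Jk (conj pW' pH')).
Qed.

(** Two distinct matrices, all ones and zero, force the sign. It makes the step sizes positive,
    since these are bounded below only by [LW + 2 * rho0] and [LH + 2 * rho0]. *)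
Lemma lipschitz_const_ge0 (R : realType) (m k : nat) (L : R)
    (G : 'M[R]_(m, k) -> 'M[R]_(m, k)) : (0 < m)%N -> (0 < k)%N ->
  (forall A B, mnorm (G A - G B) <= L * mnorm (A - B)) -> 0 <= L.
Proof.
case: m G => // m; case: k => // k G _ _ /(_ (const_mx 1) 0) GL.
have := le_trans (mnorm_ge0 _) GL; rewrite subr0 pmulr_lge0//.
rewrite lt_neqAle mnorm_ge0 andbT eq_sym; apply/eqP => /mnorm_eq0/matrixP/(_ ord0 ord0).
by rewrite !mxE => /eqP; rewrite oner_eq0.
Qed.

(** * Rates for the scalar recursion *)

Section Rates.
Variables (R : realType) (r : nat -> R) (a theta : R) (K : nat).
Hypothesis r_ge0 : forall k, 0 <= r k.
Hypothesis r_dec : forall k, r k.+1 <= r k.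
Hypothesis r_cvg : forall eps, 0 < eps -> exists N, r N < eps.
Hypothesis a_gt0 : 0 < a.
Hypothesis r_step : forall k, (K <= k)%N -> 0 < r k.+1 ->
  a * powR (r k.+1) (2 * (1 - theta)) <= r k - r k.+1.

Lemma rate_nonincr i j : (i <= j)%N -> r j <= r i.
Proof. exact: (nonincreasing_seqP _).1 r_dec i j. Qed.

Lemma rate_eventually eps : 0 < eps ->
  exists2 N, (K <= N)%N & forall k, (N <= k)%N -> r k < eps.
Proof.
move=> /r_cvg[N rN]; exists (maxn K N); first exact: leq_maxl.
move=> k; rewrite geq_max => /andP[_ Nk].
exact: le_lt_trans (rate_nonincr Nk) rN.
Qed.

(** The exponent is [0], so a step ending at a positive value costs at least [a]; this is impossible
    once [r k < a]. *)
Lemma finite_rate : theta = 1 -> exists k3, forall k, (k3 <= k)%N -> r k = 0.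
Proof.
move=> th; have [N KN rN] := rate_eventually a_gt0.
exists N.+1 => -[//|k] Nk; apply/eqP; rewrite eq_le r_ge0 andbT leNgt.
apply/negP => rk; have := r_step (leq_trans KN Nk) rk.
rewrite th subrr mulr0 powRr0 mulr1.
by have := rN k Nk; lra.
Qed.

(** Here [2 * (1 - theta) <= 1], so for [r <= 1] the power dominates [r] itself and
    [(1 + a) * r k.+1 <= r k]; hence [P = (1 + a)^-1]. *)
Lemma linear_rate N : 1 / 2 <= theta < 1 -> (K <= N)%N ->
  (forall k, (N <= k)%N -> r k <= 1) ->
  exists2 P, 0 <= P < 1 & forall k, (N <= k)%N -> r k <= r N * P ^+ (k - N).
Proof.
move=> /andP[th1 th2] KN r1.
have aV : (1 + a)^-1 * (1 + a) = 1 by rewrite mulVf// gt_eqF// addr_gt0.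
have aV0 : 0 < (1 + a)^-1 by rewrite invr_gt0 addr_gt0.
have aVa := mulr_gt0 aV0 a_gt0.
exists (1 + a)^-1; first by apply/andP; split; lra.
move=> k Nk; rewrite -(subnKC Nk); elim: (k - N)%N => [|j IH].
  by rewrite addn0 subnn expr0 mulr1.
move: IH; rewrite !addKn addnS exprSr mulrA => IH.
set b := r N * _ in IH *.
have a0 := a_gt0.
suff : (1 + a) * r (N + j).+1 <= r (N + j) by have := r_ge0 (N + j).+1; nra.
have [r0|r0] := ltP 0 (r (N + j).+1); last first.
  have -> : r (N + j).+1 = 0 by apply/eqP; rewrite eq_le r0 r_ge0.
  by rewrite mulr0.
have := r_step (leq_trans KN (leq_addr j N)) r0.
have : powR (r (N + j).+1) 1 <= powR (r (N + j).+1) (2 * (1 - theta)).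
  rewrite /powR gt_eqF// ler_expR.
  have : ln (r (N + j).+1) <= 0.
    by apply: ln_le0; apply: r1; rewrite -addnS leq_addr.
  by move: (ln _) => l; nra.
by rewrite powRr1 ?(ltW r0)//; nra.
Qed.

(* With [u = r ^ q], [q = 1 - 2 theta], the recursion makes [1 / u] grow at least
   linearly, by [(1 + x) ^ q >= 1 + q * x / (1 + x)]. *)
Lemma inv_powR_growth q (x y : R) : 0 < q < 1 -> 0 < x -> x <= 1 ->
  a * powR x (1 + q) <= y - x ->
  q * (a / (1 + 2 * a)) + (powR y q)^-1 <= (powR x q)^-1.
Proof.
move=> /andP[q0 q1] x0 x1 xy; have a0 := a_gt0.
have xq0 : 0 < powR x q by apply: powR_gt0.
have xq1 : powR x q <= 1.
  by rewrite -(powRr0 x) /powR gt_eqF// ler_expR mul0r mulr_ge0_le0 ?ln_le0// ltW.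
set u := powR x q in xq0 xq1 *.
have xD : powR x (1 + q) = x * u by rewrite powRD ?powRr1 ?ltW// (gt_eqF x0) implybT.
set w := a * u.
have w0 : 0 < w by rewrite mulr_gt0.
have y0 : 0 < y.
  by apply: (lt_le_trans x0); rewrite -subr_ge0 (le_trans _ xy)// mulr_ge0 ?powR_ge0 ?ltW.
have yx : x * (1 + w) <= y by move: xy; rewrite xD /w; lra.
have yq0 : 0 < powR y q by apply: powR_gt0.
(* This is [ln (1 + s) <= s] at [s = (1 + w)^-1 - 1]. *)
have lnw : w / (1 + w) <= ln (1 + w).
  have w1 : 0 < (1 + w)^-1 by rewrite invr_gt0 addr_gt0.
  have wV : (1 + w)^-1 * (1 + w) = 1 by rewrite mulVf// gt_eqF// addr_gt0.
  have := @le_ln1Dx R ((1 + w)^-1 - 1); rewrite addrCA subrr addr0.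
  rewrite lnV ?posrE ?addr_gt0// => /(_ _).
  rewrite ltrBrDr addNr => /(_ w1); nra.
have yq : u * (1 + q * (w / (1 + w))) <= powR y q.
  apply: (@le_trans _ _ (powR (x * (1 + w)) q)); last first.
    by apply: ge0_ler_powR; rewrite ?nnegrE ?(ltW q0)// ?mulr_ge0 ?addr_ge0 ?ltW.
  rewrite powRM ?addr_ge0 ?(ltW x0) ?(ltW w0)// -/u ler_pM2l// /powR gt_eqF ?addr_gt0//.
  apply: le_trans (expR_ge1Dx _); rewrite lerD2l ler_pM2l//.
(* Since [u <= 1] and [q < 1], the denominator [1 + w + q * w] is at most [1 + 2 * a], which makes
   the increment uniform in [x]. *)
have wa : w <= a by rewrite /w; nra.
have a2 : 0 < 1 + 2 * a by nra.
rewrite -lerBrDr.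
have -> : q * (a / (1 + 2 * a)) = q * a / (1 + 2 * a) by rewrite mulrA.
rewrite ler_pdivrMr//.
move: (powR y q) yq yq0 => v yq v0.
have w1 : 0 < 1 + w by nra.
have w2 : 0 < 1 + w + q * w by nra.
have yq' : u * (1 + w + q * w) <= v * (1 + w).
  have -> : 1 + w + q * w = (1 + q * (w / (1 + w))) * (1 + w).
    by field; rewrite gt_eqF.
  by rewrite mulrA ler_pM2r.
have vI : v^-1 <= (1 + w) / (u * (1 + w + q * w)).
  by rewrite ler_pdivlMr ?mulr_gt0// [leLHS]mulrC ler_pdivrMr// [leRHS]mulrC.
apply: (@le_trans _ _ ((q * a / (1 + w + q * w)) * (1 + 2 * a))).
  rewrite mulrAC ler_pdivlMr// ler_pM2l ?mulr_gt0//; nra.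
rewrite ler_pM2r//.
have -> : q * a / (1 + w + q * w) = u^-1 - (1 + w) / (u * (1 + w + q * w)).
  by rewrite /w; field; rewrite !gt_eqF//= -/w.
lra.
Qed.

(** Summing the increments of [inv_powR_growth] from [N] to [k] bounds [r k ^ (- q)] below by a
    multiple of [k - N]; inverting and taking the [q]-th root gives the rate. *)
Lemma sublinear_rate N : 0 < theta < 1 / 2 -> (K <= N)%N ->
  (forall k, (N <= k)%N -> r k <= 1) ->
  exists2 Q, 0 < Q & forall k, (N < k)%N ->
    r k <= powR (Q / ((k - N)%:R * (1 - 2 * theta))) (1 / (1 - 2 * theta)).
Proof.
move=> /andP[th0 th1] KN r1; set q := 1 - 2 * theta.
have q01 : 0 < q < 1 by rewrite /q; apply/andP; split; lra.
have q0 : 0 < q by case/andP: q01.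
have a2 : 0 < 1 + 2 * a by have := a_gt0; lra.
exists ((1 + 2 * a) / a); first by rewrite divr_gt0.
(* If [r k] is positive, monotonicity makes all earlier values positive, as the recursion requires;
   otherwise the bound is trivial. *)
move=> k Nk; have [r0|r0] := ltP 0 (r k); last first.
  exact: le_trans r0 (powR_ge0 _ _).
have grow j : (N + j <= k)%N ->
    j%:R * (q * (a / (1 + 2 * a))) <= (powR (r (N + j)) q)^-1.
  elim: j => [|j IH] jk; first by rewrite mul0r invr_ge0 powR_ge0.
  have r0' : 0 < r (N + j).+1.
    by apply: lt_le_trans r0 (rate_nonincr _); rewrite -addnS.
  rewrite -natr1 mulrDl mul1r addrC addnS.
  apply: le_trans (inv_powR_growth (y := r (N + j)) q01 r0' _ _).
  - by rewrite lerD2l IH// (leq_trans _ jk)// addnS.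
  - by apply: r1; rewrite -addnS leq_addr.
  - have -> : 1 + q = 2 * (1 - theta) by rewrite /q; ring.
    exact: r_step (leq_trans KN (leq_addr j N)) r0'.
have := grow (k - N)%N; rewrite subnKC ?(ltnW Nk)// => /(_ (leqnn _)) {}grow.
have kN : 0 < (k - N)%:R :> R by rewrite ltr0n subn_gt0.
have u0 : 0 < powR (r k) q by apply: powR_gt0.
have : powR (r k) q <= (1 + 2 * a) / a / ((k - N)%:R * q).
  rewrite ler_pdivlMr ?mulr_gt0// ler_pdivlMr//.
  move: grow; rewrite -(ler_pM2r u0) mulVf ?gt_eqF// -(ler_pM2r a2) mul1r.
  apply: le_trans; rewrite le_eqVlt; apply/orP; left; apply/eqP.
  by field; rewrite gt_eqF.
move=> /(ge0_ler_powR (r := 1 / q)).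
rewrite -powRrM mulrCA mulfV ?gt_eqF// mulr1 powRr1 ?(ltW r0)//; apply.
- by rewrite divr_ge0// ltW.
- by rewrite nnegrE powR_ge0.
- by rewrite nnegrE !mulr_ge0 ?invr_ge0 ?mulr_ge0 ?ltW.
Qed.

End Rates.

(** * Convergence rates of accPALM *)

Theorem theorem2 (R : realType) (p r n : nat)
  (F : pt R p r n -> R) (f : 'M[R]_(p, r) -> \bar R) (g : 'M[R]_(r, n) -> \bar R)
  (gradW : pt R p r n -> 'M[R]_(p, r)) (gradH : pt R p r n -> 'M[R]_(r, n))
  (LW LH rho0 betamax cbar dbar : R)
  (beta ck dk : nat -> R) (z : nat -> pt R p r n)
  (Jstar c theta : R) :
  (0 < p)%N -> (0 < r)%N -> (0 < n)%N ->
  (* Standing Assumption (a) *)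
  proper_mx f -> lsc_mx f -> proper_mx g -> lsc_mx g ->
  (* (b) *)
  (exists m : R, forall w : pt R p r n,
     (m%:E <= (F w)%:E + f w.1 + g w.2)%E) ->
  (exists m : R, forall W, (m%:E <= f W)%E) ->
  (exists m : R, forall H, (m%:E <= g H)%E) ->
  (* (c) F is C^1 with gradient (gradW, gradH) *)
  (forall w : pt R p r n, forall eps : R, 0 < eps -> exists2 del : R, 0 < del &
     forall h : pt R p r n, pnorm h < del ->
       `| F (padd w h) - F w - pdot (gradW w, gradH w) h | <= eps * pnorm h) ->
  (forall w : pt R p r n, forall eps : R, 0 < eps -> exists2 del : R, 0 < del &
     forall u : pt R p r n, pnorm (psub u w) < del ->
       pnorm (psub (gradW u, gradH u) (gradW w, gradH w)) < eps) ->
  (forall (W1 W2 : 'M[R]_(p, r)) (H : 'M[R]_(r, n)),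
     mnorm (gradW (W1, H) - gradW (W2, H)) <= LW * mnorm (W1 - W2)) ->
  (forall (W : 'M[R]_(p, r)) (H1 H2 : 'M[R]_(r, n)),
     mnorm (gradH (W, H1) - gradH (W, H2)) <= LH * mnorm (H1 - H2)) ->
  (* grad F Lipschitz continuous on bounded sets *)
  (forall M : R, exists L : R, forall z1 z2 : pt R p r n,
     pnorm z1 <= M -> pnorm z2 <= M ->
     pnorm (psub (gradW z1, gradH z1) (gradW z2, gradH z2))
       <= L * pnorm (psub z1 z2)) ->
  (* accPALM parameters *)
  0 < rho0 -> 0 <= betamax < 1 ->
  (forall k, 0 <= beta k <= betamax) ->
  (forall k, LW + 2 * rho0 <= ck k <= cbar) ->
  (forall k, LH + 2 * rho0 <= dk k <= dbar) ->
  (* initial point, z^{-1} = z^0 *)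
  (f (z 0%N).1 < +oo)%E -> (g (z 0%N).2 < +oo)%E ->
  (forall k, accPALM_step F f g gradW gradH rho0 (beta k) (ck k) (dk k)
     (if k is k'.+1 then z k' else z 0%N) (z k) (z k.+1)) ->
  (* bounded sequence *)
  (exists M : R, forall k, pnorm (z k) <= M) ->
  (* J = J* on omega(z^0) *)
  (forall zbar, limit_point z zbar ->
     ((F zbar)%:E + f zbar.1 + g zbar.2)%E = Jstar%:E) ->
  (* KL at the points of omega(z^0) with phi(t) = c/theta t^theta,
     i.e. phi'(t) = c t^(theta - 1) *)
  0 < theta <= 1 -> 0 < c ->
  (forall zbar, limit_point z zbar ->
     KL_at (fun w : pt R p r n => ((F w)%:E + f w.1 + g w.2)%E) zbar
       (fun t => c * powR t (theta - 1))) ->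
  let rk := fun k => (((F (z k))%:E + f (z k).1 + g (z k).2) - Jstar%:E)%E in
  exists k2 : nat,
    (theta = 1 -> exists k3 : nat, forall k, (k3 <= k)%N -> rk k = 0%E) /\
    (1 / 2 <= theta < 1 -> exists2 P : R, 0 <= P < 1 &
       forall k, (k2 <= k)%N -> (rk k <= rk k2 * (P ^+ (k - k2))%:E)%E) /\
    (0 < theta < 1 / 2 -> exists2 Q : R, 0 < Q &
       forall k, (k2 < k)%N ->
         (rk k <= (powR (Q / ((k - k2)%:R * (1 - 2 * theta)))
                        (1 / (1 - 2 * theta)))%:E)%E).
Proof.
move=> p0 r0 n0 fp fl gp gl _ _ _ Fd _ lW lH lipB rho0_gt0 /andP[bm0 bm1] bk ckb dkb.
move=> f0 g0 step [M zM] Jom /andP[th0 th1] c0 KL rk.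
have LW0 : 0 <= LW.
  exact: (@lipschitz_const_ge0 R p r LW (fun W => gradW (W, 0))) p0 r0 _.
have LH0 : 0 <= LH.
  exact: (@lipschitz_const_ge0 R r n LH (fun H => gradH (0, H))) r0 n0 _.
have ck_bnd k : 0 < ck k <= cbar.
  by have /andP[h1 ->] := ckb k; rewrite andbT; lra.
have dk_bnd k : 0 < dk k <= dbar.
  by have /andP[h1 ->] := dkb k; rewrite andbT; lra.
have anchor k : (objective F f g (z k) < +oo)%E -> exists y,
    [/\ pnorm y <= 3 * M, palm_step f g gradW gradH (ck k) (dk k) y (z k.+1) &
     (objective F f g (z k.+1) <=
      objective F f g (z k) - (rho0 * pnorm2 (psub (z k.+1) y))%:E)%E].
  move=> Jk; have [ck0 _] := andP (ck_bnd k); have [dk0 _] := andP (dk_bnd k).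
  have [cL _] := andP (ckb k); have [dL _] := andP (dkb k).
  have bk1 : 0 <= beta k <= 1.
    by have /andP[-> h] := bk k; rewrite (le_trans h (ltW bm1)).
  apply: (accPALM_anchor fp gp Fd lW lH ck0 dk0 cL dL bk1 _ (zM k) Jk (step k)).
  by case: k {Jk ck0 dk0 cL dL bk1}.
have z0_fin : (objective F f g (z 0%N) < +oo)%E.
  by rewrite /objective !lte_add_pinfty ?ltry.
(* Finiteness must be propagated first: an anchor with descent is available only from an iterate of
   finite value. *)
have z_fin k : (objective F f g (z k) < +oo)%E.
  elim: k => // k IH; have [y [_ _ h]] := anchor k IH; apply: le_lt_trans h _.
  by have [a [b [_ _ ->]]] := objective_fin fp gp IH; rewrite -EFinB ltry.
have /choice[y yP] := fun k => anchor k (z_fin k).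
have y_bnd k : pnorm (y k) <= 3 * M by have [] := yP k.
have z_step k : palm_step f g gradW gradH (ck k) (dk k) (y k) (z k.+1) by have [] := yP k.
have z_desc k : (objective F f g (z k.+1) <=
    objective F f g (z k) - (rho0 * pnorm2 (psub (z k.+1) (y k)))%:E)%E.
  by have [] := yP k.
have [L grad_lip] := lipB (4 * M).
have Jsle := Jstar_le fp gp fl gl Fd rho0_gt0 z_desc z0_fin zM Jom.
have Jcvg := Jr_cvg fp gp fl gl Fd rho0_gt0 z_step z_desc z0_fin zM y_bnd ck_bnd
  dk_bnd grad_lip Jom.
have [a a0 [K Krec]] := Jr_recursion fp gp fl gl Fd rho0_gt0 z_step z_desc z0_fin zM
  y_bnd ck_bnd dk_bnd grad_lip Jom c0 KL.
pose rr k := fine (objective F f g (z k)) - Jstar.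
have rkE k : rk k = (rr k)%:E.
  by rewrite /rk -/(objective F f g (z k)) (z_fine fp gp z_desc z0_fin).
have rr_ge0 k : 0 <= rr k by rewrite subr_ge0.
have rr_dec k : rr k.+1 <= rr k.
  by rewrite lerB// (Jr_nonincr fp gp rho0_gt0 z_desc z0_fin).
have rr_cvg (eps : R) : 0 < eps -> exists N, rr N < eps.
  by move=> /Jcvg[N NP]; exists N; rewrite /rr ltrBlDl.
(* This [N] serves as [k2] in all three cases: the recursion is valid from [K <= N] on, and the gaps
   are at most [1]. *)
have [N KN N1] := rate_eventually K rr_dec rr_cvg ltr01.
have {}N1 k : (N <= k)%N -> rr k <= 1 by move/N1/ltW.
exists N; split; [|split].
- move=> th; have [k3 k3P] := finite_rate rr_ge0 rr_dec rr_cvg a0 Krec th.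
  by exists k3 => k /k3P rk0; rewrite rkE rk0.
- move=> th; have [P P01 PP] := linear_rate rr_ge0 a0 Krec th KN N1.
  by exists P => // k /PP; rewrite !rkE -EFinM lee_fin.
- move=> th; have [Q Q0 QP] := sublinear_rate rr_dec a0 Krec th KN N1.
  by exists Q => // k /QP; rewrite rkE lee_fin.
Qed.
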